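(* Let $X$ be a finite simple cycle set with nilpotent displacement group $\mathrm{Dis}(X)$. Then $|X|=p^k$ for a prime number $p$ and a natural number $k$.
   Context: A left quasigroup $(X,\cdot)$ is a non-empty set with a binary operation such that $\sigma_x:y\mapsto x\cdot y$ is bijective for every $x$. A cycle set is a left quasigroup with $(x\cdot y)\cdot(x\cdot z)=(y\cdot x)\cdot(y\cdot z)$ for all $x,y,z$; all cycle sets are assumed non-degenerate, i.e. $x\mapsto x\cdot x$ is bijective. $\mathcal{G}(X)=\langle\sigma_x\mid x\in X\rangle\le \mathrm{Sym}(X)$; $X$ is indecomposable if $\mathcal{G}(X)$ is transitive on $X$. The displacement group $\mathrm{Dis}(X)$ is the normal closure of $\{\sigma_x\sigma_y^{-1}\mid x,y\in X\}$ in $\mathcal{G}(X)$. A congruence is an equivalence relation $\sim$ such that $x\sim x'$ and $y\sim y'$ imply $x\cdot y\sim x'\cdot y'$ and $\sigma_x^{-1}(y)\sim\sigma_{x'}^{-1}(y')$. $X$ is simple if it is indecomposable and its only congruences are the equality relation and the all relation. Natural numbers include $0$ (the case of a singleton). *)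

(* Defs.v *)
From mathcomp Require Import all_boot all_fingroup all_solvable.
Set Implicit Arguments. Unset Strict Implicit. Unset Printing Implicit Defensive.
Local Open Scope group_scope.

Record finLeftQuasigroup := FinLeftQuasigroup {
  lq_sort :> finType;
  lq_op : lq_sort -> lq_sort -> lq_sort;
  lq_nonempty : (0 < #|lq_sort|)%N;
  lq_bij : forall x, bijective (lq_op x) }.

Arguments lq_op {_} _ _.

Notation "x ·> y" := (lq_op x y) (at level 40, left associativity).

Definition sigma (X : finLeftQuasigroup) (x : X) : {perm X} :=
  perm (bij_inj (lq_bij x)).

Lemma sigmaE (X : finLeftQuasigroup) (x y : X) : sigma x y = x ·> y.
Proof. by rewrite permE. Qed.

Definition nondegenerate (X : finLeftQuasigroup) : Prop :=
  bijective (fun x : X => x ·> x).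

Definition cycle_set (X : finLeftQuasigroup) : Prop :=
  (forall x y z : X, (x ·> y) ·> (x ·> z) = (y ·> x) ·> (y ·> z))
  /\ nondegenerate X.

Definition perm_group (X : finLeftQuasigroup) : {set {perm X}} :=
  <<[set sigma x | x in [set: X]]>>.

Definition indecomposable (X : finLeftQuasigroup) : Prop :=
  [transitive perm_group X, on [set: X] | 'P].

(* Products in {perm X} compose from left to right, so the composite function
   sigma_x o sigma_y^-1 is (sigma y)^-1 * sigma x. *)
Definition displacements (X : finLeftQuasigroup) : {set {perm X}} :=
  [set (sigma y)^-1 * sigma x | x in [set: X], y in [set: X]].

(* The normal closure in perm_group X is generated by all the conjugates. *)
Definition Dis (X : finLeftQuasigroup) : {set {perm X}} :=
  <<class_support (displacements X) (perm_group X)>>.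

Definition congruence (X : finLeftQuasigroup) (R : rel X) : Prop :=
  equivalence_rel R /\
  forall x x' y y' : X, R x x' -> R y y' ->
    R (x ·> y) (x' ·> y') /\ R ((sigma x)^-1 y) ((sigma x')^-1 y').

(* A one-element left quasigroup is simple. *)
Definition simple_lq (X : finLeftQuasigroup) : Prop :=
  indecomposable X /\
  forall R : rel X, congruence R ->
    (forall x y, R x y = (x == y)) \/ (forall x y, R x y).

(* Main.v *)
Require Import Defs.
From mathcomp Require Import all_boot all_fingroup all_solvable.

(** The maps [T_x : g |-> g sigma_(g x)] on Sym(X) commute by the cycle set
    identity and are injective by non-degeneracy, so they generate an abelian
    group A; it plays the role of the additive group of the brace G(X), its
    orbit of 1 being G(X). Left multiplication by any g in Sym(X) conjugates
    [T_(g x)] to [T_x], hence normalises A and its Hall p'-subgroup A', and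
    therefore the orbit H of 1 under A' is a subgroup, in fact a Hall
    p'-subgroup of G(X). If Dis(X) is nilpotent, [N = H :&: Dis X] is its
    p'-core, which is normal in G(X), and the orbits of N form a congruence.
    By simplicity, for p dividing |X|, the group N cannot be transitive, so it
    is trivial; as Dis(X) is transitive unless it is trivial, |X| is a power
    of p. *)

Set Implicit Arguments. Unset Strict Implicit. Unset Printing Implicit Defensive.
Local Open Scope group_scope.

Canonical perm_group_group (X : finLeftQuasigroup) :=
  [group of perm_group X].
Canonical Dis_group (X : finLeftQuasigroup) := [group of Dis X].

Section LeftTranslations.
Variable gT : finGroupType.

Definition ltransl (g : gT) : {perm gT} := perm (mulgI g).

Lemma ltranslE g h : ltransl g h = g * h.
Proof. by rewrite permE. Qed.

(** Conjugation by left multiplication moves the evaluation point from [g] to [1], so values of [b]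
    become products in [gT]. *)
Lemma perm_ltransl (b : {perm gT}) (g : gT) :
  b g = g * (b ^ (ltransl g)^-1) 1.
Proof.
by rewrite conjgE invgK !permM -ltranslE permKV ltranslE mulg1.
Qed.

Lemma group_set_orbit1 (B : {group {perm gT}}) :
  (forall g, ltransl g \in 'N(B)) -> group_set (orbit 'P B 1).
Proof.
move=> nB; apply/group_setP; split; first exact: orbit_refl.
move=> _ _ /orbitP[a Ba <-] /orbitP[b Bb <-] /=.
(* By [perm_ltransl] at [a 1], this element sends [1] to [a 1 * b 1]. *)
apply/orbitP; exists (a * b ^ (ltransl (a 1))).
  by rewrite groupM // memJ_norm.
by rewrite /= /aperm permM perm_ltransl conjgK.
Qed.

End LeftTranslations.

(** As [B] is normal and Hall in [A], its stabiliser of [u] is Hall in that of [A]; compare pi-parts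
    in the orbit-stabiliser formula. *)
Lemma card_orbit_Hall (T : finType) (pi : nat_pred) (A B : {group {perm T}})
    (u : T) :
  B <| A -> pi.-Hall(A) B -> #|orbit 'P B u| = (#|orbit 'P A u|`_pi)%N.
Proof.
move=> nBA hB.
have hS : pi.-Hall('C_A[u | 'P]) 'C_B[u | 'P].
  rewrite -(setIidPl (normal_sub nBA)) -setIA.
  exact: setI_normal_Hall nBA hB (subsetIl _ _).
have := card_orbit_stab 'P A u => /(congr1 (partn^~ pi)).
rewrite partnM ?cardG_gt0 //; last by apply/card_gt0P; exists u; exact: orbit_refl.
rewrite -(card_Hall hB) -(card_Hall hS) -(card_orbit_stab 'P B u).
by move/eqP; rewrite eqn_pmul2r ?cardG_gt0 // => /eqP.
Qed.

Section Translations.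
Variable X : finLeftQuasigroup.
Hypothesis hX : cycle_set X.

Let cycleE (x y z : X) : (x ·> y) ·> (x ·> z) = (y ·> x) ·> (y ·> z).
Proof. exact: hX.1. Qed.

Lemma add_sigma_inj (x : X) :
  injective (fun g : {perm X} => g * sigma (g x)).
Proof.
move=> g h /= E; have := congr1 (fun s : {perm X} => s x) E.
rewrite !permM !sigmaE => /(bij_inj hX.2) Ex.
by move: E; rewrite Ex => /mulIg.
Qed.

Definition add_sigma (x : X) : {perm {perm X}} := perm (@add_sigma_inj x).

Lemma add_sigmaE x g : add_sigma x g = g * sigma (g x).
Proof. by rewrite permE. Qed.

Definition add_group : {group {perm {perm X}}} :=
  [group of <<[set add_sigma x | x in [set: X]]>>].

Lemma mem_add_sigma x : add_sigma x \in add_group.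
Proof. by rewrite mem_gen // imset_f. Qed.

Lemma add_group_abelian : abelian add_group.
Proof.
rewrite abelian_gen; apply/centsP => _ /imsetP[x _ ->] _ /imsetP[y _ ->].
(* This becomes the cycle identity at [g x], [g y], [g z]. *)
apply/permP=> g; apply/permP=> z.
by rewrite !permM !add_sigmaE !permM !sigmaE cycleE.
Qed.

Lemma add_sigmaJ (g : {perm X}) x :
  add_sigma (g x) ^ ltransl g = add_sigma x.
Proof.
apply/permP=> h; rewrite conjgE !permM.
have [k ->] : exists k, h = ltransl g k.
  by exists (g^-1 * h); rewrite ltranslE mulKVg.
by rewrite permK !(ltranslE, add_sigmaE) permM mulgA.
Qed.

Lemma ltransl_norm_add (g : {perm X}) : ltransl g \in 'N(add_group).
Proof.
rewrite -sub1set norms_gen // sub1set inE.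
apply/subsetP=> _ /imsetP[_ /imsetP[x _ ->] ->].
by rewrite -(permKV g x) add_sigmaJ imset_f.
Qed.

Lemma orbit_add_group : orbit 'P add_group 1 = perm_group X.
Proof.
apply/eqP; rewrite eqEsubset; apply/andP; split.
  have GT : [acts add_group, on perm_group X | 'P].
    rewrite gen_subG; apply/subsetP=> _ /imsetP[x _ ->].
    rewrite !inE /=; apply/subsetP=> g Gg.
    by rewrite inE /= /aperm add_sigmaE groupM // mem_gen // imset_f.
  by rewrite (acts_sub_orbit _ GT) group1.
(* The orbit is a group, so it suffices that it contains each [sigma x], the image of [1] under
   [add_sigma x]. *)
have gO := group_set_orbit1 ltransl_norm_add.
rewrite -[orbit _ _ _]/(gval (Group gO)) gen_subG /=.
apply/subsetP=> _ /imsetP[x _ ->]; apply/orbitP; exists (add_sigma x).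
  exact: mem_add_sigma.
by rewrite /= /aperm add_sigmaE mul1g perm1.
Qed.

Section HallSubgroup.
Variable pi : nat_pred.

Lemma ltransl_norm_core (g : {perm X}) : ltransl g \in 'N('O_pi(add_group)).
Proof.
exact: subsetP (char_norms (pcore_char _ _)) _ (ltransl_norm_add g).
Qed.

Definition brace_Hall : {group {perm X}} :=
  Group (group_set_orbit1 ltransl_norm_core).

Lemma brace_Hall_pHall : pi.-Hall(perm_group X) brace_Hall.
Proof.
have nAc : 'O_pi(add_group) <| add_group := pcore_normal _ _.
have hA : pi.-Hall(add_group) 'O_pi(add_group).
  exact: nilpotent_pcore_Hall (abelian_nil add_group_abelian).
rewrite pHallE /=; apply/andP; split.
  rewrite -orbit_add_group; apply/subsetP=> _ /orbitP[a Aa <-].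
  by apply/orbitP; exists a => //; exact: subsetP (normal_sub nAc) _ Aa.
by rewrite -orbit_add_group /= (card_orbit_Hall _ nAc hA).
Qed.

(** Write [n] as [a 1]. Since [a] commutes with [add_sigma x], [n * sigma (n x)] equals
    [a (sigma x)], which is [sigma x] times the value at [1] of a conjugate of [a] in the core. *)
Lemma sigma_brace_Hall x n :
  n \in brace_Hall -> (sigma x)^-1 * n * sigma (n x) \in brace_Hall.
Proof.
case/orbitP=> a Aa Ea.
have An := subsetP (pcore_sub pi add_group) _ Aa.
have cTa : commute a (add_sigma x).
  by apply: (centsP add_group_abelian) => //; exact: mem_add_sigma.
have E : n * sigma (n x) = sigma x * (a ^ (ltransl (sigma x))^-1) 1.
  rewrite -perm_ltransl -add_sigmaE -Ea /= /aperm -permM cTa permM add_sigmaE.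
  by rewrite mul1g perm1.
rewrite -mulgA E mulKg; apply/orbitP; exists (a ^ (ltransl (sigma x))^-1) => //.
by rewrite memJ_norm // groupV ltransl_norm_core.
Qed.

End HallSubgroup.

End Translations.

Section Congruences.
Variable X : finLeftQuasigroup.

Lemma mem_sigma (x : X) : sigma x \in perm_group X.
Proof. by rewrite mem_gen // imset_f. Qed.

Lemma mem_Dis (x y : X) : (sigma y)^-1 * sigma x \in Dis X.
Proof.
apply: mem_gen; apply/imset2P; exists ((sigma y)^-1 * sigma x) 1.
- by apply/imset2P; exists x y; rewrite ?inE.
- exact: group1.
- by rewrite conjg1.
Qed.

Lemma Dis_normal : Dis X <| perm_group X.
Proof.
apply/andP; split; last first.
  by apply: norms_gen; exact: class_support_norm.
rewrite gen_subG class_support_sub_norm ?normG //.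
by apply/subsetP=> _ /imset2P[x y _ _ ->]; rewrite groupM ?groupV ?mem_sigma.
Qed.

(** The second hypothesis makes [sigma] constant modulo [N] on each orbit; normality then moves
    elements of [N] past [sigma x]. *)
Lemma orbit_congruence (N : {group {perm X}}) :
  perm_group X \subset 'N(N) ->
  (forall x n, n \in N -> (sigma x)^-1 * sigma (n x) \in N) ->
  congruence (fun x y => y \in orbit 'P N x).
Proof.
move=> nN hN; have nNx x : sigma x \in 'N(N).
  exact: subsetP nN _ (mem_sigma x).
split=> [x y z|].
  by split=> [|/orbit_eqP->]; first exact: orbit_refl.
move=> x x' y y' /orbitP[n Nn <-] /orbitP[m Nm <-] /=; rewrite /aperm.
have [s Ns Es] : exists2 s, s \in N & sigma (n x) = sigma x * s.
  by exists ((sigma x)^-1 * sigma (n x)); [exact: hN | rewrite mulKVg].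
split; apply/orbitP.
  exists (m ^ sigma x * s); first by rewrite groupM ?memJ_norm.
  by rewrite -!sigmaE Es /= /aperm -!permM conjgE !mulgA mulgV mul1g.
exists ((m * s^-1) ^ (sigma x)^-1).
  by rewrite memJ_norm ?groupV // groupM // groupV.
by rewrite Es /= /aperm -!permM conjgE invgK invMg !mulgA mulVg mul1g.
Qed.

Lemma simple_orbits (N : {group {perm X}}) :
  simple_lq X -> congruence (fun x y => y \in orbit 'P N x) ->
  N :=: 1 \/ [transitive N, on [set: X] | 'P].
Proof.
case=> _ simX /simX[E | E]; [left | right].
  apply/trivgP/subsetP=> n Nn; rewrite inE; apply/eqP/permP=> x.
  by apply/eqP; rewrite perm1 eq_sym -E; apply/orbitP; exists n.
have /card_gt0P[x _] := lq_nonempty X.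
apply/imsetP; exists x; first by rewrite inE.
by apply/setP=> y; rewrite inE E.
Qed.

Lemma Dis_trivial_abelian : Dis X = 1 -> abelian (perm_group X).
Proof.
move=> D1; rewrite abelian_gen; apply/centsP=> _ /imsetP[x _ ->] _ /imsetP[y _ ->].
have := mem_Dis x y; rewrite D1 inE => /eqP/(canRL (mulKg _)).
by rewrite mulg1 invgK => ->; exact: commute_refl.
Qed.

Lemma simple_transitive_Dis :
  simple_lq X -> Dis X = 1 \/ [transitive Dis X, on [set: X] | 'P].
Proof.
move=> simX; apply: (@simple_orbits (Dis_group X) simX).
apply: orbit_congruence => [|x n _]; first exact: normal_norm Dis_normal.
exact: mem_Dis.
Qed.

(** [K] is kept general so as to cover both [Dis X] and, when [Dis X] is trivial, the whole
    permutation group. *)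
Lemma pcore_congruence (pi : nat_pred) (K : {group {perm X}}) :
    cycle_set X -> K <| perm_group X -> Dis X \subset K -> nilpotent K ->
  congruence (fun x y => y \in orbit 'P 'O_pi(K) x).
Proof.
move=> hX nKG sDK nilK; set N := 'O_pi(K).
have nNG : perm_group X \subset 'N(N).
  exact: char_norm_trans (pcore_char _ _) (normal_norm nKG).
set H := brace_Hall hX pi.
have defN : H :&: K = N.
  have hN : pi.-Hall(K) N := nilpotent_pcore_Hall pi nilK.
  have hH : pi.-Hall(K) (H :&: K).
    exact: Hall_setI_normal nKG (brace_Hall_pHall _ _).
  exact: eq_Hall_pcore hN hH.
apply: orbit_congruence => // x n Nn.
have /setIP[Hn _] : n \in H :&: K by rewrite defN.
have /setIP[Hnx _] : n ^ sigma x \in H :&: K.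
  by rewrite defN memJ_norm // (subsetP nNG) ?mem_sigma.
suff: (sigma x)^-1 * sigma (n x) \in H :&: K by rewrite defN.
rewrite inE; apply/andP; split; last exact: subsetP sDK _ (mem_Dis _ _).
(* Multiplying on the left by [n ^ sigma x], which lies in [H], gives the element of
   [sigma_brace_Hall]. *)
rewrite -(groupMl _ Hnx) conjgE !mulgA mulgK.
exact: sigma_brace_Hall.
Qed.

Lemma simple_nilpotent_transitive (p : nat) (K : {group {perm X}}) :
    prime p -> p %| #|X| ->
    cycle_set X -> simple_lq X -> K <| perm_group X -> Dis X \subset K ->
    nilpotent K -> [transitive K, on [set: X] | 'P] ->
  p.-nat #|X|.
Proof.
move=> p_pr p_dvd hX simX nKG sDK nilK tK.
have [N1|tN] := simple_orbits simX (pcore_congruence p^' hX nKG sDK nilK).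
  have pK : p.-group K.
    by rewrite -(nilpotent_pcoreC p nilK) N1 dprodg1 pcore_pgroup.
  by apply: pnat_dvd pK; rewrite -cardsT (atrans_dvd tK).
(* A transitive p'-core would have order divisible by [#|X|], hence by [p]. *)
have p'N : p^'.-group 'O_p^'(K) := pcore_pgroup _ _.
move: p'N; rewrite /pgroup p'natE // (dvdn_trans p_dvd) //.
by rewrite -cardsT (atrans_dvd tN).
Qed.

End Congruences.

Theorem corollary41 (X : finLeftQuasigroup) (hcycle : cycle_set X)
    (hsimple : simple_lq X) (hnil : nilpotent (Dis X)) :
  exists p k : nat, prime p /\ #|X| = (p ^ k)%N.
Proof.
have [X1|X_gt1] := leqP #|X| 1.
  exists 2, 0; split=> //.
  by apply/eqP; rewrite eqn_leq X1 lq_nonempty.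
have p_pr := pdiv_prime X_gt1.
suff /p_natP[k Ek] : (pdiv #|X|).-nat #|X| by exists (pdiv #|X|), k.
have [D1|tD] := simple_transitive_Dis hsimple.
  (* With no displacements all [sigma x] coincide, so the permutation group is abelian, and it is
     transitive by indecomposability. *)
  apply: (@simple_nilpotent_transitive X _ (perm_group_group X)) => //=.
  - exact: pdiv_dvd.
  - exact: normal_sub (Dis_normal X).
  - exact: abelian_nil (Dis_trivial_abelian D1).
  - exact: hsimple.1.
apply: (@simple_nilpotent_transitive X _ (Dis_group X)) => //=.
- exact: pdiv_dvd.
- exact: Dis_normal.
Qed.
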